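(* Let $d\in\mathbb{N}^*$, let $P_i,Q_i,R_i,S_i\in\mathcal{B}(\mathcal{H})$ for $1\le i\le d$, let $T_i=\begin{pmatrix}P_i&Q_i\\R_i&S_i\end{pmatrix}$ be the corresponding operator on $\mathcal{H}\oplus\mathcal{H}$, and let $\mathbf{T}=(T_1,\dots,T_d)$, $\mathbf{P}=(P_1,\dots,P_d)$, $\mathbf{S}=(S_1,\dots,S_d)$. Let $q\in\mathbb{C}$ with $|q|\le1$. Then $$\max\{Jt\omega_q^2(\mathbf{P}),Jt\omega_q^2(\mathbf{S})\}\le Jt\omega_q^2(\mathbf{T})\le\sum_{i=1}^d\Big(\frac{|q|}{2}\Big(\omega(P_i)+\omega(S_i)+\sqrt{(\omega(P_i)-\omega(S_i))^2+(\|R_i\|+\|Q_i\|)^2}\Big)+\sqrt{1-|q|^2}\,\big(\|P_i\|^2+\|Q_i\|^2+\|R_i\|^2+\|S_i\|^2\big)^{1/2}\Big)^2.$$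
   Context: $\mathbb{N}^*$ is the set of positive integers. $\mathcal{H}$ is a complex Hilbert space with $\dim\mathcal{H}\ge 2$ and $\mathcal{B}(\mathcal{H})$ is the algebra of bounded linear operators on $\mathcal{H}$ with operator norm $\|\cdot\|$; $\omega(T)=\sup\{|\langle Tx,x\rangle|:\|x\|=1\}$ is the numerical radius. For a Hilbert space $\mathcal{K}$, put $\mathbb{S}_q(\mathcal{K})=\{(x,y)\in\mathcal{K}\times\mathcal{K}: \|x\|=\|y\|=1,\ \langle x,y\rangle=q\}$. For a tuple $\mathbf{B}=(B_1,\dots,B_d)$ of bounded operators on $\mathcal{K}$, the joint $q$-numerical radius is $Jt\omega_q(\mathbf{B})=\sup\{(\sum_{i=1}^d|\langle B_ix,y\rangle|^2)^{1/2} : (x,y)\in\mathbb{S}_q(\mathcal{K})\}$, and $Jt\omega_q^2(\mathbf{B})=(Jt\omega_q(\mathbf{B}))^2$. Here $\mathcal{K}=\mathcal{H}$ for $\mathbf{P},\mathbf{S}$ and $\mathcal{K}=\mathcal{H}\oplus\mathcal{H}$ (Hilbert direct sum) for $\mathbf{T}$. *)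

(* Defs.v *)
From HB Require Import structures.
From mathcomp Require Import all_boot all_order all_algebra sesquilinear.
From mathcomp Require Import complex ring.
From mathcomp Require Import all_classical all_reals topology normedtype.

Set Implicit Arguments.
Unset Strict Implicit.
Unset Printing Implicit Defensive.
Import Order.TTheory GRing.Theory Num.Theory.
Import numFieldNormedType.Exports.
Local Open Scope classical_set_scope.
Local Open Scope ring_scope.

(* The inner product is linear in its first argument and conjugate-linear in
   its second one. *)
HB.mixin Record CompleteNormedModule_isHilbert (R : realType) (H : Type)
    & CompleteNormedModule R[i] H := {
  inner : {dot H for (@Num.conj R[i])} ;
  sqr_norm_inner : forall x : H, `|x| ^+ 2 = inner x x
}.

#[short(type="hilbertType")]
HB.structure Definition Hilbert (R : realType) :=
  {H of CompleteNormedModule R[i] H & CompleteNormedModule_isHilbert R H}.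

Arguments inner {R s}.

Definition dim_ge (K : numFieldType) (n : nat) (V : lmodType K) : Prop :=
  exists e : 'I_n -> V, forall a : 'I_n -> K,
    \sum_i a i *: e i = 0 -> forall i, a i = 0.

HB.mixin Record isBounded (K : numFieldType) (U V : normedModType K)
    (f : U -> V) := {
  bounded_subproof : exists M : K, forall x : U, `|f x| <= M * `|x|
}.

#[short(type="boundedLinear")]
HB.structure Definition BoundedLinear (K : numFieldType)
    (U V : normedModType K) :=
  {f of @isBounded K U V f & @GRing.Linear K U V *:%R f}.

(* Norms over R[i], including the modulus on R[i] itself, are valued in R[i];
   their suprema are computed in R through the real part. As sup is 0 on empty
   and on unbounded sets, the quantities below are meaningful because the
   operators are bounded and, when |q| <= 1, qsphere K q is nonempty as soon as
   dim K >= 2. *)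
Definition rnorm (R : realType) (V : normedZmodType R[i]) (x : V) : R :=
  complex.Re `|x|.

Section Norms.
Context {R : realType}.

Definition opnorm (U V : normedModType R[i]) (T : boundedLinear U V) : R :=
  sup [set rnorm (T x) | x in [set x : U | rnorm x <= 1]].

Definition numradius (H : hilbertType R) (T : boundedLinear H H) : R :=
  sup [set rnorm (inner (T x) x) | x in [set x : H | rnorm x = 1]].

Definition qsphere (K : hilbertType R) (q : R[i]) : set (K * K) :=
  [set p | [/\ rnorm p.1 = 1, rnorm p.2 = 1 & inner p.1 p.2 = q]].
Arguments qsphere K q : clear implicits.

Definition Jtnumradius (K : hilbertType R) (d : nat) (q : R[i])
    (B : 'I_d -> boundedLinear K K) : R :=
  sup [set Num.sqrt (\sum_(i < d) rnorm (inner (B i p.1) p.2) ^+ 2)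
      | p in qsphere K q].

End Norms.

(* The library norm on H1 * H2 is the sup norm, hence a separate carrier for
   the Hilbert direct sum. *)
Definition hsum (R : realType) (H1 H2 : hilbertType R) : Type :=
  (H1 * H2)%type.

Section DirectSum.
Context {R : realType} {H1 H2 : hilbertType R}.
Local Notation S := (hsum H1 H2).

HB.instance Definition _ := GRing.Lmodule.copy S (H1 * H2)%type.

Definition hsum_norm (x : S) : R[i] := sqrtC (`|x.1| ^+ 2 + `|x.2| ^+ 2).

Let norm2_ge0 (a b : R[i]) : 0 <= a -> 0 <= b -> 0 <= a ^+ 2 + b ^+ 2.
Proof. by move=> a0 b0; rewrite addr_ge0 // exprn_ge0. Qed.

Let hsum_norm_ge0 (x : S) : 0 <= hsum_norm x.
Proof. by rewrite sqrtC_ge0 norm2_ge0. Qed.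

Lemma le_hsum_norm1 (x : S) : `|x.1| <= hsum_norm x.
Proof.
rewrite -[leLHS]sqrCK // ler_sqrtC ?qualifE/= ?exprn_ge0 ?norm2_ge0 //.
by rewrite lerDl exprn_ge0.
Qed.

Lemma le_hsum_norm2 (x : S) : `|x.2| <= hsum_norm x.
Proof.
rewrite -[leLHS]sqrCK // ler_sqrtC ?qualifE/= ?exprn_ge0 ?norm2_ge0 //.
by rewrite lerDr exprn_ge0.
Qed.

Lemma hsum_norm_le (x : S) : hsum_norm x <= `|x.1| + `|x.2|.
Proof.
rewrite -[leRHS]sqrCK ?addr_ge0 // ler_sqrtC ?qualifE/= ?norm2_ge0 //.
  by rewrite sqrrD addrAC lerDl mulrn_wge0 ?mulr_ge0.
by rewrite exprn_ge0 ?addr_ge0.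
Qed.

Let hsum_norm0_eq0 (x : S) : hsum_norm x = 0 -> x = 0.
Proof.
move=> x0; have := le_hsum_norm1 x; have := le_hsum_norm2 x.
rewrite x0 !normr_le0 => /eqP x20 /eqP x10.
by case: x x10 x20 {x0} => a b /= -> ->.
Qed.

Let hsum_normZ (l : R[i]) (x : S) : hsum_norm (l *: x) = `|l| * hsum_norm x.
Proof.
rewrite /hsum_norm /= !normrZ !exprMn -mulrDr sqrtCM ?qualifE/= ?norm2_ge0 //.
  by rewrite sqrCK.
by rewrite exprn_ge0.
Qed.

Let minkowski (a b c d : R[i]) : 0 <= a -> 0 <= b -> 0 <= c -> 0 <= d ->
  sqrtC ((a + c) ^+ 2 + (b + d) ^+ 2) <=
  sqrtC (a ^+ 2 + b ^+ 2) + sqrtC (c ^+ 2 + d ^+ 2).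
Proof.
move=> a0 b0 c0 d0.
have ab0 := norm2_ge0 a0 b0; have cd0 := norm2_ge0 c0 d0.
have s0 : 0 <= sqrtC (a ^+ 2 + b ^+ 2) + sqrtC (c ^+ 2 + d ^+ 2).
  by rewrite addr_ge0 ?sqrtC_ge0.
rewrite -[leRHS]sqrCK // ler_sqrtC ?qualifE/= ?exprn_ge0 ?norm2_ge0 ?addr_ge0
  ?sqrtC_ge0 //.
rewrite [leRHS]sqrrD !sqrtCK -sqrtCM //.
have -> : (a + c) ^+ 2 + (b + d) ^+ 2 =
    a ^+ 2 + b ^+ 2 + (a * c + b * d) *+ 2 + (c ^+ 2 + d ^+ 2) by ring.
rewrite lerD2r lerD2l lerMn2r /=.
have p0 : 0 <= a * c + b * d by rewrite addr_ge0 ?mulr_ge0.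
rewrite -[leLHS]sqrCK // ler_sqrtC ?qualifE/= ?exprn_ge0 ?mulr_ge0
  ?sqrtC_ge0 //.
rewrite -subr_ge0.
have -> : (a ^+ 2 + b ^+ 2) * (c ^+ 2 + d ^+ 2) - (a * c + b * d) ^+ 2 =
    (a * d - b * c) ^+ 2 by ring.
apply: real_exprn_even_ge0 => //.
by rewrite rpredB // ger0_real // mulr_ge0.
Qed.

Let hsum_normD (x y : S) : hsum_norm (x + y) <= hsum_norm x + hsum_norm y.
Proof.
apply: (le_trans _ (minkowski _ _ _ _)) => //.
rewrite ler_sqrtC ?qualifE/= ?norm2_ge0 ?addr_ge0 //.
by rewrite lerD // lerXn2r ?qualifE/= ?addr_ge0 ?ler_normD.
Qed.

HB.instance Definition _ :=
  Lmodule_isNormed.Build R[i] S hsum_normD hsum_normZ hsum_norm0_eq0.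

Let hsum_complete (F : set_system S) : ProperFilter F -> cauchy F -> cvg F.
Proof.
move=> FF /cauchy_ballP Fc.
have c1 : cauchy (fst @ F : set_system H1).
  apply/cauchy_ballP => e e0; have [[A B] [FA FB] AB] := Fc e e0.
  exists (fst @` A, fst @` B).
    by split; [apply: filterS FA | apply: filterS FB] => x Dx; exists x.
  move=> [_ _] [[x Ax <-] [y By <-]] /=.
  move: (AB (x, y) (conj Ax By)); rewrite -!ball_normE /=.
  exact: le_lt_trans (le_hsum_norm1 (x - y)).
have c2 : cauchy (snd @ F : set_system H2).
  apply/cauchy_ballP => e e0; have [[A B] [FA FB] AB] := Fc e e0.
  exists (snd @` A, snd @` B).
    by split; [apply: filterS FA | apply: filterS FB] => x Dx; exists x.
  move=> [_ _] [[x Ax <-] [y By <-]] /=.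
  move: (AB (x, y) (conj Ax By)); rewrite -!ball_normE /=.
  exact: le_lt_trans (le_hsum_norm2 (x - y)).
move/cauchy_cvg : c1 => /cvg_ex[l1 /cvgrPdist_lt Fl1].
move/cauchy_cvg : c2 => /cvg_ex[l2 /cvgrPdist_lt Fl2].
apply/cvg_ex; exists ((l1, l2) : S); apply/fcvgrPdist_lt => e e0.
have e20 : 0 < e / 2 by rewrite divr_gt0.
near=> x; apply: le_lt_trans (hsum_norm_le _) _.
by rewrite [e]splitr ltrD //=; near: x; [apply: Fl1 | apply: Fl2].
Unshelve. all: by end_near.
Qed.

HB.instance Definition _ := Uniform_isComplete.Build S hsum_complete.

Definition hsum_inner (x y : S) : R[i] := inner x.1 y.1 + inner x.2 y.2.

Let hsum_inner_bilinear :
  bilinear_for *%R (@Num.conj R[i] \; *%R) hsum_inner.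
Proof.
split=> [z a x y|z a x y]; rewrite /hsum_inner /=.
  by rewrite !linearPl mulrDr addrACA.
by rewrite !linearPr /= mulrDr addrACA.
Qed.

HB.instance Definition _ :=
  @bilinear_isBilinear.Build R[i] S S R[i] _ _ hsum_inner hsum_inner_bilinear.

Let hsum_inner_hermitian (x y : S) :
  hsum_inner x y = (-1) ^+ false * Num.conj (hsum_inner y x).
Proof.
rewrite /hsum_inner rmorphD mulrDr.
by rewrite [inner x.1 y.1]hermC [inner x.2 y.2]hermC.
Qed.

HB.instance Definition _ := @isHermitianSesquilinear.Build R[i] S false
  (@Num.conj R[i]) hsum_inner hsum_inner_hermitian.

Let hsum_inner_gt0 (x : S) : x != 0 -> 0 < hsum_inner x x.
Proof.
move=> x0; rewrite /hsum_inner -!sqr_norm_inner lt_neqAle norm2_ge0 // andbT.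
apply: contraNneq x0 => e0; apply/eqP/hsum_norm0_eq0.
by rewrite /hsum_norm -e0 sqrtC0.
Qed.

HB.instance Definition _ := isDotProduct.Build R[i] S hsum_inner hsum_inner_gt0.

Let hsum_sqr_norm (x : S) :
  `|x| ^+ 2 = (hsum_inner : {dot S for (@Num.conj R[i])}) x x.
Proof. by rewrite [`|x|]/(hsum_norm x) sqrtCK !sqr_norm_inner. Qed.

HB.instance Definition _ :=
  CompleteNormedModule_isHilbert.Build R S hsum_sqr_norm.

End DirectSum.

Section Block.
Context {R : realType} {H1 H2 : hilbertType R}.
Variables (P : boundedLinear H1 H1) (Q : boundedLinear H2 H1)
          (C : boundedLinear H1 H2) (S : boundedLinear H2 H2).

Definition block_op (x : hsum H1 H2) : hsum H1 H2 :=
  (P x.1 + Q x.2, C x.1 + S x.2).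

Let block_op_linear : linear block_op.
Proof.
move=> a x y; by congr pair => /=; rewrite !linearP scalerDr addrACA.
Qed.

HB.instance Definition _ :=
  GRing.isLinear.Build R[i] _ _ *:%R block_op block_op_linear.

Let block_op_bounded : exists M : R[i], forall x, `|block_op x| <= M * `|x|.
Proof.
have bd (X Y : hilbertType R) (f : boundedLinear X Y) :
    exists2 M : R[i], 0 <= M & forall x, `|f x| <= M * `|x|.
  have [M fM] := @bounded_subproof _ _ _ f.
  have [M0|M0] := boolP (0 <= M); first by exists M.
  exists 0 => // x; rewrite mul0r.
  have [->|x0] := eqVneq x 0; first by rewrite linear0 normr0.
  have := le_trans (normr_ge0 _) (fM x).
  by rewrite pmulr_lge0 ?normr_gt0 // (negPf M0).
have [p p0 Pp] := bd _ _ P; have [q q0 Qq] := bd _ _ Q.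
have [u u0 Uu] := bd _ _ C; have [v v0 Vv] := bd _ _ S.
exists (p + q + (u + v)) => x.
apply: le_trans (hsum_norm_le _) _; rewrite /= mulrDl lerD //.
- apply: le_trans (ler_normD _ _) _; rewrite mulrDl lerD //.
  + by apply: le_trans (Pp _) _; rewrite ler_wpM2l // le_hsum_norm1.
  + by apply: le_trans (Qq _) _; rewrite ler_wpM2l // le_hsum_norm2.
- apply: le_trans (ler_normD _ _) _; rewrite mulrDl lerD //.
  + by apply: le_trans (Uu _) _; rewrite ler_wpM2l // le_hsum_norm1.
  + by apply: le_trans (Vv _) _; rewrite ler_wpM2l // le_hsum_norm2.
Qed.

HB.instance Definition _ := isBounded.Build R[i] _ _ block_op block_op_bounded.
End Block.

(* Main.v *)
Require Import Defs.
From mathcomp Require Import all_boot all_order all_algebra sesquilinear.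
From mathcomp Require Import complex ring lra.
From mathcomp Require Import all_classical all_reals topology normedtype.

(** For unit vectors x, y with inner x y = q, the component of y orthogonal
    to x is w = y - q^* x, and it has norm sqrt(1 - |q|^2).  Hence, for every z,
    inner z y = q * inner z x + inner z w, and Cauchy-Schwarz bounds the second
    term by sqrt(1 - |q|^2) |z| ([rnorm_inner_qsphere_le]).  Apply this to
    z = T x, for a block operator T with entries P, Q, C, S and a unit vector
    x = (x1, x2); two estimates are then needed.

    - |T x| is at most the Frobenius norm of the 2 x 2 matrix of operator norms,
      by Cauchy-Schwarz in the plane on each row ([rnorm_block_op_le]).
    - With s = |x1| and t = |x2|, |inner (T x) x| is at most the value at (s, t)
      of the quadratic form w(P) s^2 + w(S) t^2 + (|C| + |Q|) s t, which on the
      unit circle does not exceed the largest eigenvalue of its symmetric 2 x 2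
      matrix ([rnorm_inner_block_op_le], [quadratic_form_le]).

    Adding these up for each index gives the upper bound termwise, uniformly
    over the pairs (x, y), and thus for the supremum.

    The lower bounds hold because x |-> (x, 0) and x |-> (0, x) are isometries
    that preserve the condition inner x y = q and compress the block operators
    to P and S ([Jtnumradius_le_isometry]).

    Since a supremum in R is 0 by convention for an empty or unbounded set, a
    value is below its supremum only because the operators are bounded, and the
    case without any pair (x, y) is treated apart. *)

Set Implicit Arguments.
Unset Strict Implicit.
Unset Printing Implicit Defensive.
Import Order.TTheory GRing.Theory Num.Theory.
Local Open Scope classical_set_scope.
Local Open Scope ring_scope.

(** * Inequalities in the plane *)

Lemma sqrD_le_cauchy (R : realDomainType) (a b s t : R) :
  (a * s + b * t) ^+ 2 <= (a ^+ 2 + b ^+ 2) * (s ^+ 2 + t ^+ 2).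
Proof.
rewrite -subr_ge0.
suff -> : (a ^+ 2 + b ^+ 2) * (s ^+ 2 + t ^+ 2) - (a * s + b * t) ^+ 2 =
  (a * t - b * s) ^+ 2 by exact: sqr_ge0.
by ring.
Qed.

(** The factor on the right is the largest eigenvalue of the symmetric matrix
    with diagonal a, b and off-diagonal entry c / 2.  In terms of the double
    angle, whose coordinates are s^2 - t^2 and 2 s t and whose length is
    s^2 + t^2, the traceless part of the form becomes a scalar product with
    (a - b, c), so planar Cauchy-Schwarz applies. *)
Lemma quadratic_form_le (R : rcfType) (a b c s t : R) :
  a * s ^+ 2 + b * t ^+ 2 + c * (s * t) <=
    (a + b + Num.sqrt ((a - b) ^+ 2 + c ^+ 2)) / 2 * (s ^+ 2 + t ^+ 2).
Proof.
have n0 : 0 <= s ^+ 2 + t ^+ 2 by rewrite addr_ge0 ?sqr_ge0.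
have h : (a - b) * (s ^+ 2 - t ^+ 2) + c * (s * t *+ 2) <=
    Num.sqrt ((a - b) ^+ 2 + c ^+ 2) * (s ^+ 2 + t ^+ 2).
  apply: le_trans (ler_norm _) _; rewrite -sqrtr_sqr.
  rewrite -[X in _ <= _ * X](ger0_norm n0) -sqrtr_sqr.
  rewrite -sqrtrM ?addr_ge0 ?sqr_ge0//.
  apply: ler_wsqrtr; apply: le_trans (sqrD_le_cauchy _ _ _ _) _.
  by rewrite le_eqVlt; apply/orP; left; apply/eqP; ring.
by lra.
Qed.

(** * Real-valued norms and inner products *)

Section RealNorm.
Context {R : realType}.

Lemma rnormE (V : normedZmodType R[i]) (x : V) : `|x| = (rnorm x)%:C%C.
Proof.
apply/eqP; rewrite eq_complex /= /rnorm eqxx /=.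
by rewrite ger0_Im.
Qed.

Lemma rnorm_ge0 (V : normedZmodType R[i]) (x : V) : 0 <= rnorm x.
Proof. by have := normr_ge0 x; rewrite rnormE -[0]/(0%:C%C) lecR. Qed.

Lemma rnorm0 (V : normedZmodType R[i]) : rnorm (0 : V) = 0.
Proof. by rewrite /rnorm normr0. Qed.

Lemma rnorm_gt0 (V : normedZmodType R[i]) (x : V) : (0 < rnorm x) = (x != 0).
Proof. by rewrite -normr_gt0 rnormE -[in RHS]/(0%:C%C) ltcR. Qed.

Lemma ler_rnormD (V : normedZmodType R[i]) (x y : V) :
  rnorm (x + y) <= rnorm x + rnorm y.
Proof. by rewrite -lecR rmorphD /= -!rnormE ler_normD. Qed.

Lemma rnormM (a b : R[i]) : rnorm (a * b) = rnorm a * rnorm b.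
Proof. by apply: complexI; rewrite rmorphM /= -!rnormE normrM. Qed.

Lemma rnormZ (V : normedModType R[i]) (a : R[i]) (x : V) :
  rnorm (a *: x) = rnorm a * rnorm x.
Proof. by apply: complexI; rewrite rmorphM /= -!rnormE normrZ. Qed.

Lemma rnorm_conj (a : R[i]) : rnorm a^* = rnorm a.
Proof. by rewrite /rnorm norm_conjC. Qed.

Lemma rnorm_real (a : R) : 0 <= a -> rnorm (a%:C%C) = a.
Proof. by move=> a0; rewrite /rnorm ger0_norm ?lecR. Qed.

End RealNorm.

Section InnerProduct.
Context {R : realType} {K : hilbertType R}.
Implicit Types x y : K.

Lemma inner_rnorm x : inner x x = (rnorm x ^+ 2)%:C%C.
Proof. by rewrite -sqr_norm_inner rnormE rmorphXn. Qed.

Lemma innerZr a x y : inner x (a *: y) = a^* * inner x y.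
Proof. by rewrite linearZr_LR. Qed.

(** The usual argument: the vector n x - a y, with a = inner x y and
    n = inner y y, has a nonnegative square norm, equal to
    n (n inner x x - |a|^2). *)
Lemma rnorm_inner_le x y : rnorm (inner x y) <= rnorm x * rnorm y.
Proof.
have [->|y0] := eqVneq y 0.
  by rewrite linear0r !rnorm0 mulr0.
have n0 : 0 < inner y y by rewrite dnorm_gt0.
set a := inner x y; set n := inner y y.
rewrite -(@ler_pXn2r _ 2) ?nnegrE ?mulr_ge0 ?rnorm_ge0//.
rewrite exprMn -lecR [leRHS]rmorphM /= -!inner_rnorm rmorphXn /= -rnormE.
rewrite -subr_ge0 -(pmulr_rge0 _ n0) -/n.
have nC : n^* = n by apply/CrealP/gtr0_real.
have := dnorm_ge0 (inner (s := K)) (n *: x - a *: y).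
rewrite dnormB !dnormZ linearZl_LR /= innerZr /= -/a -/n rmorphM rmorphM /= nC.
rewrite conjCK (gtr0_norm n0) normCK.
set b := a^*.
by congr (0 <= _); ring.
Qed.

End InnerProduct.

(** * Operator norm and numerical radius *)

Lemma sup_ge0 (R : realType) (A : set R) :
  (forall x, A x -> 0 <= x) -> 0 <= sup A.
Proof.
move=> A0; have [[[x Ax] ubA]|/sup_out ->//] := pselect (has_sup A).
exact: le_trans (A0 _ Ax) (ub_le_sup ubA Ax).
Qed.

Section BoundedOperators.
Context {R : realType}.

(** The bound of a bounded operator is an element of R[i]; it is replaced by its
    modulus, which is a bound as well: where x != 0 the bound is nonnegative. *)
Lemma bounded_rnorm (U V : normedModType R[i]) (T : boundedLinear U V) :
  exists2 M : R, 0 <= M & forall x, rnorm (T x) <= M * rnorm x.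
Proof.
have [M TM] := @bounded_subproof _ _ _ T.
exists (rnorm M) => [|x]; first exact: rnorm_ge0.
rewrite -rnormZ -lecR -!rnormE normrZ.
have := TM x; have := normr_ge0 (T x).
move=> /le_trans h /[dup] /h M0.
move=> /le_trans; apply.
by rewrite -(ger0_norm M0) normrM normr_id.
Qed.

Lemma le_opnorm (U V : normedModType R[i]) (T : boundedLinear U V) (x : U) :
  rnorm (T x) <= opnorm T * rnorm x.
Proof.
have [->|x0] := eqVneq x 0; first by rewrite linear0 !rnorm0 mulr0.
have [M M0 TM] := bounded_rnorm T.
have rx : 0 < rnorm x by rewrite rnorm_gt0.
have cx : rnorm ((rnorm x)^-1%:C%C) = (rnorm x)^-1.
  by rewrite rnorm_real// invr_ge0 ltW.
rewrite -ler_pdivrMr// mulrC -[in leLHS]cx -rnormZ -linearZ /=.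
apply: ub_le_sup.
  exists M => _ [y y1 <-]; apply: le_trans (TM y) _.
  by rewrite -[leRHS]mulr1 ler_wpM2l.
exists ((rnorm x)^-1%:C%C *: x) => //=.
by rewrite rnormZ cx mulVf// gt_eqF.
Qed.

Lemma opnorm_ge0 (U V : normedModType R[i]) (T : boundedLinear U V) :
  0 <= opnorm T.
Proof.
by apply: sup_ge0 => _ [x _ <-]; exact: rnorm_ge0.
Qed.

Lemma le_numradius (K : hilbertType R) (T : boundedLinear K K) (x : K) :
  rnorm (inner (T x) x) <= numradius T * rnorm x ^+ 2.
Proof.
have [->|x0] := eqVneq x 0; first by rewrite linear0r !rnorm0 expr0n mulr0.
have rx : 0 < rnorm x by rewrite rnorm_gt0.
have cx : rnorm ((rnorm x)^-1%:C%C) = (rnorm x)^-1.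
  by rewrite rnorm_real// invr_ge0 ltW.
set c := (rnorm x)^-1%:C%C in cx.
have -> : rnorm (inner (T x) x) =
    rnorm (inner (T (c *: x)) (c *: x)) * rnorm x ^+ 2.
  rewrite innerZr [T (_ *: _)]linearZ /= linearZl_LR /= !rnormM rnorm_conj cx.
  by field; rewrite gt_eqF.
apply: ler_wpM2r; first exact: sqr_ge0.
apply: ub_le_sup.
  exists (opnorm T) => _ [y y1 <-]; apply: le_trans (rnorm_inner_le _ _) _.
  by rewrite y1 mulr1 (le_trans (le_opnorm _ _))// y1 mulr1.
exists (c *: x) => //=.
by rewrite rnormZ cx mulVf// gt_eqF.
Qed.

End BoundedOperators.

(** * The joint q-numerical radius *)

Section JointNumericalRadius.
Context {R : realType} {K : hilbertType R} {d : nat} {q : R[i]}.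
Implicit Types B : 'I_d -> boundedLinear K K.

Lemma Jtnumradius_ge0 B : 0 <= Jtnumradius q B.
Proof. by apply: sup_ge0 => _ [p _ <-]; exact: sqrtr_ge0. Qed.

Lemma le_Jtnumradius B p : qsphere q p ->
  Num.sqrt (\sum_(i < d) rnorm (inner (B i p.1) p.2) ^+ 2) <= Jtnumradius q B.
Proof.
move=> qp; apply: ub_le_sup; last by exists p.
exists (Num.sqrt (\sum_(i < d) opnorm (B i) ^+ 2)) => _ [[x y] [/= x1 y1 _] <-].
rewrite ler_wsqrtr// ler_sum// => i _.
rewrite lerXn2r ?nnegrE ?rnorm_ge0 ?opnorm_ge0//.
apply: le_trans (rnorm_inner_le _ _) _.
by rewrite y1 mulr1 (le_trans (le_opnorm _ _))// x1 mulr1.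
Qed.

(** The termwise bounds are uniform over the pairs, so their sum of squares also
    bounds the supremum; over an empty set of pairs the supremum is 0. *)
Lemma sqr_Jtnumradius_le B (M : 'I_d -> R) :
  (forall p, qsphere q p -> forall i, rnorm (inner (B i p.1) p.2) <= M i) ->
  Jtnumradius q B ^+ 2 <= \sum_(i < d) M i ^+ 2.
Proof.
move=> BM; have s0 : 0 <= \sum_(i < d) M i ^+ 2.
  by rewrite sumr_ge0// => i _; exact: sqr_ge0.
rewrite -(sqr_sqrtr s0) lerXn2r ?nnegrE ?sqrtr_ge0 ?Jtnumradius_ge0//.
have [S0|/set0P S0] := eqVneq (qsphere q : set (K * K)) set0.
  by rewrite /Jtnumradius S0 image_set0 sup0 sqrtr_ge0.
apply: ge_sup; first exact: image_nonempty.
move=> _ [p qp <-]; rewrite ler_wsqrtr// ler_sum// => i _.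
have Mi := BM p qp i.
by rewrite lerXn2r ?nnegrE ?rnorm_ge0// (le_trans (rnorm_ge0 _) Mi).
Qed.

(** Here y = q^* x + w with w orthogonal to x, so |w|^2 = 1 - |q|^2: the first
    term on the right is the contribution of q^* x, the second one is
    Cauchy-Schwarz for z and w. *)
Lemma rnorm_inner_qsphere_le (p : K * K) z : qsphere q p ->
  rnorm (inner z p.2) <=
    rnorm q * rnorm (inner z p.1) + Num.sqrt (1 - rnorm q ^+ 2) * rnorm z.
Proof.
case: p => x y [/= x1 y1 xyq].
have w2 : rnorm (y - q^* *: x) ^+ 2 = 1 - rnorm q ^+ 2.
  apply: complexI; rewrite -inner_rnorm dnormB dnormZ innerZr /= conjCK.
  rewrite !inner_rnorm x1 y1 norm_conjC rnormE rmorphB /= !rmorphXn /= !rmorph1.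
  rewrite [inner y x]hermC /= xyq expr0 mul1r rmorphM /= conjCK -normCK rnormE.
  by rewrite [q^* * q]mulrC -normCK rnormE; ring.
have -> : inner z y = q * inner z x + inner z (y - q^* *: x).
  by rewrite linearBr /= innerZr /= conjCK addrC subrK.
apply: le_trans (ler_rnormD _ _) _; rewrite rnormM lerD2l.
apply: le_trans (rnorm_inner_le _ _) _.
by rewrite mulrC -w2 sqrtr_sqr ger0_norm ?rnorm_ge0.
Qed.

End JointNumericalRadius.

(** * Block operators *)

Section Block.
Context {R : realType} {H1 H2 : hilbertType R}.

Lemma hsum_innerE (x y : hsum H1 H2) :
  inner x y = inner x.1 y.1 + inner x.2 y.2.
Proof. by []. Qed.

Lemma sqr_rnorm_hsum (x : hsum H1 H2) :
  rnorm x ^+ 2 = rnorm x.1 ^+ 2 + rnorm x.2 ^+ 2.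
Proof. by apply: complexI; rewrite rmorphD /= -!inner_rnorm. Qed.

Variables (P : boundedLinear H1 H1) (Q : boundedLinear H2 H1)
          (C : boundedLinear H1 H2) (S : boundedLinear H2 H2).

(** Cauchy-Schwarz in the plane bounds the norm of each component of the image
    by the Euclidean norm of the corresponding row of operator norms. *)
Lemma rnorm_block_op_le (x : hsum H1 H2) :
  rnorm (block_op P Q C S x) <=
    Num.sqrt (opnorm P ^+ 2 + opnorm Q ^+ 2 + opnorm C ^+ 2 + opnorm S ^+ 2) *
    rnorm x.
Proof.
have row (V : hilbertType R) (A : boundedLinear H1 V) (B : boundedLinear H2 V) :
    rnorm (A x.1 + B x.2) ^+ 2 <=
      (opnorm A ^+ 2 + opnorm B ^+ 2) * rnorm x ^+ 2.
  rewrite sqr_rnorm_hsum; apply: le_trans (sqrD_le_cauchy _ _ _ _).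
  rewrite lerXn2r ?nnegrE ?addr_ge0 ?mulr_ge0 ?rnorm_ge0 ?opnorm_ge0//.
  by apply: le_trans (ler_rnormD _ _) _; rewrite lerD ?le_opnorm.
rewrite -[X in _ <= _ * X]ger0_norm ?rnorm_ge0// -[X in _ <= _ * X]sqrtr_sqr.
rewrite -sqrtrM ?addr_ge0 ?sqr_ge0//.
rewrite -[leLHS]ger0_norm ?rnorm_ge0// -sqrtr_sqr ler_wsqrtr//.
by rewrite sqr_rnorm_hsum -addrA mulrDl lerD ?row.
Qed.

(** The diagonal blocks are controlled by their numerical radii, while the
    off-diagonal ones each contribute at most their norm times |x.1| |x.2|; what
    results is a quadratic form in |x.1| and |x.2|. *)
Lemma rnorm_inner_block_op_le (x : hsum H1 H2) :
  rnorm (inner (block_op P Q C S x) x) <=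
    (numradius P + numradius S +
      Num.sqrt ((numradius P - numradius S) ^+ 2 + (opnorm C + opnorm Q) ^+ 2))
      / 2 * rnorm x ^+ 2.
Proof.
rewrite sqr_rnorm_hsum; apply: le_trans (quadratic_form_le _ _ _ _ _).
have -> : inner (block_op P Q C S x) x =
    inner (P x.1) x.1 + inner (S x.2) x.2 +
    (inner (C x.1) x.2 + inner (Q x.2) x.1).
  by rewrite hsum_innerE /= !linearDl /=; ring.
apply: le_trans (ler_rnormD _ _) _; apply: lerD.
  by apply: le_trans (ler_rnormD _ _) _; rewrite lerD ?le_numradius.
apply: le_trans (ler_rnormD _ _) _; rewrite mulrDl lerD//.
  rewrite mulrA (le_trans (rnorm_inner_le _ _))//.
  by rewrite ler_wpM2r ?rnorm_ge0 ?le_opnorm.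
rewrite [X in _ * X]mulrC mulrA (le_trans (rnorm_inner_le _ _))//.
by rewrite ler_wpM2r ?rnorm_ge0 ?le_opnorm.
Qed.

End Block.

(** * Compression to a subspace *)

Section Compression.
Context {R : realType} {H1 H2 : hilbertType R} {d : nat} {q : R[i]}.

(** An isometry maps the q-sphere of K into that of L, and here it preserves the
    values whose supremum is taken. *)
Lemma Jtnumradius_le_isometry (K L : hilbertType R) (f : K -> L)
    (B : 'I_d -> boundedLinear K K) (T : 'I_d -> boundedLinear L L) :
    (forall x y, inner (f x) (f y) = inner x y) ->
    (forall i x y, inner (T i (f x)) (f y) = inner (B i x) y) ->
  Jtnumradius q B ^+ 2 <= Jtnumradius q T ^+ 2.
Proof.
move=> fi fT; have fn x : rnorm (f x) = rnorm x.
  apply/eqP; rewrite -(@eqrXn2 _ 2) ?rnorm_ge0//; apply/eqP/complexI.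
  by rewrite -!inner_rnorm.
rewrite lerXn2r ?nnegrE ?Jtnumradius_ge0//.
have [S0|/set0P S0] := eqVneq (qsphere q : set (K * K)) set0.
  by rewrite {1}/Jtnumradius S0 image_set0 sup0 Jtnumradius_ge0.
apply: ge_sup; first exact: image_nonempty.
move=> _ [[x y] [/= x1 y1 xyq] <-].
under eq_bigr do rewrite -fT.
by apply: (@le_Jtnumradius _ _ _ _ _ (f x, f y)); split; rewrite /= ?fn ?fi.
Qed.

Variables (P : 'I_d -> boundedLinear H1 H1) (Q : 'I_d -> boundedLinear H2 H1)
  (C : 'I_d -> boundedLinear H1 H2) (S : 'I_d -> boundedLinear H2 H2).
Let T i : boundedLinear (hsum H1 H2) (hsum H1 H2) :=
  block_op (P i) (Q i) (C i) (S i).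

Lemma Jtnumradius_block_op_ge1 : Jtnumradius q P ^+ 2 <= Jtnumradius q T ^+ 2.
Proof.
apply: (@Jtnumradius_le_isometry _ _ (fun x => (x, 0) : hsum H1 H2)).
  by move=> x y; rewrite hsum_innerE /= linear0r addr0.
by move=> i x y; rewrite hsum_innerE /= !linear0 !addr0.
Qed.

Lemma Jtnumradius_block_op_ge2 : Jtnumradius q S ^+ 2 <= Jtnumradius q T ^+ 2.
Proof.
apply: (@Jtnumradius_le_isometry _ _ (fun x => (0, x) : hsum H1 H2)).
  by move=> x y; rewrite hsum_innerE /= linear0r add0r.
by move=> i x y; rewrite hsum_innerE /= !linear0 !add0r.
Qed.

End Compression.

(** * The block operator estimates *)

Theorem theorem17 (R : realType) (H : hilbertType R) (dimH : dim_ge 2 H)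
    (d : nat) (d_gt0 : (0 < d)%N) (P_ Q_ R_ S_ : 'I_d -> boundedLinear H H)
    (q : R[i]) (q_le1 : rnorm q <= 1) :
  let T_ : 'I_d -> boundedLinear (hsum H H) (hsum H H) :=
    fun i => block_op (P_ i) (Q_ i) (R_ i) (S_ i) in
  Num.max (Jtnumradius q P_ ^+ 2) (Jtnumradius q S_ ^+ 2)
    <= Jtnumradius q T_ ^+ 2
  /\
  Jtnumradius q T_ ^+ 2 <=
    \sum_(i < d)
      (rnorm q / 2 *
         (numradius (P_ i) + numradius (S_ i) +
          Num.sqrt ((numradius (P_ i) - numradius (S_ i)) ^+ 2 +
                    (opnorm (R_ i) + opnorm (Q_ i)) ^+ 2))
       + Num.sqrt (1 - rnorm q ^+ 2) *
         Num.sqrt (opnorm (P_ i) ^+ 2 + opnorm (Q_ i) ^+ 2 +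
                   opnorm (R_ i) ^+ 2 + opnorm (S_ i) ^+ 2)) ^+ 2.
Proof.
move=> T_; split.
  by rewrite ge_max Jtnumradius_block_op_ge1 Jtnumradius_block_op_ge2.
apply: sqr_Jtnumradius_le => p qp i; have [p1 _ _] := qp.
apply: le_trans (rnorm_inner_qsphere_le _ qp) _; apply: lerD.
  rewrite mulrAC -mulrA ler_wpM2l ?rnorm_ge0//.
  apply: le_trans (rnorm_inner_block_op_le _ _ _ _ _) _.
  by rewrite p1 expr1n mulr1.
rewrite ler_wpM2l ?sqrtr_ge0//.
by apply: le_trans (rnorm_block_op_le _ _ _ _ _) _; rewrite p1 mulr1.
Qed.
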